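(* For all real numbers $a,b>0$, $$M_{SA}(a,b)\le \tfrac13 M_{SH}(a,b)\le \tfrac12 M_{AH}(a,b)\le \tfrac12 M_{SG}(a,b)\le M_{AG}(a,b).$$
   Context: For $a,b>0$ define the means $H(a,b)=\frac{2ab}{a+b}$, $G(a,b)=\sqrt{ab}$, $A(a,b)=\frac{a+b}{2}$, $S(a,b)=\sqrt{\frac{a^2+b^2}{2}}$. The differences of means are $M_{SA}=S-A$, $M_{SH}=S-H$, $M_{AH}=A-H$, $M_{SG}=S-G$, $M_{AG}=A-G$, each evaluated at $(a,b)$. *)

(* Defs.v *)
From Stdlib Require Import Reals.
Open Scope R_scope.

Definition mean_H (a b : R) : R := 2 * a * b / (a + b).
Definition mean_G (a b : R) : R := sqrt (a * b).
Definition mean_A (a b : R) : R := (a + b) / 2.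
Definition mean_S (a b : R) : R := sqrt ((a ^ 2 + b ^ 2) / 2).

Definition M_SA (a b : R) : R := mean_S a b - mean_A a b.
Definition M_SH (a b : R) : R := mean_S a b - mean_H a b.
Definition M_AH (a b : R) : R := mean_A a b - mean_H a b.
Definition M_SG (a b : R) : R := mean_S a b - mean_G a b.
Definition M_AG (a b : R) : R := mean_A a b - mean_G a b.

(* Main.v *)
Require Import Defs.
From Stdlib Require Import Reals Lra.
Open Scope R_scope.

(** The chain involves [a] and [b] only through the four means, and these are
    tied together by two identities:
    S^2 + G^2 = 2 A^2 and G^2 = A H.
    After clearing denominators the four inequalities reduce to three.
    - The first two are the same inequality, 2 S <= 3 A - H.  Eliminating G
      gives S^2 = 2 A^2 - A H, so (3 A - H)^2 - (2 S)^2 = (A - H)^2.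
    - The last one is S + G <= 2 A: A is the quadratic mean of S and G, hence
      at least their arithmetic mean.
    - The third, A - H <= S - G, follows from the last, because
      (S - G)(S + G) = 2 (A^2 - G^2) = 2 A (A - H), and S + G <= 2 A. *)

Lemma mean_A_pos a b : 0 < a -> 0 < b -> 0 < mean_A a b.
Proof. unfold mean_A; lra. Qed.

Lemma mean_S_sqr_add_mean_G_sqr a b : 0 < a -> 0 < b ->
  mean_S a b ^ 2 + mean_G a b ^ 2 = 2 * mean_A a b ^ 2.
Proof.
intros ha hb; unfold mean_S, mean_G, mean_A.
rewrite !pow2_sqrt by nra; field.
Qed.

Lemma mean_G_sqr a b : 0 < a -> 0 < b ->
  mean_G a b ^ 2 = mean_A a b * mean_H a b.
Proof.
intros ha hb; unfold mean_G, mean_A, mean_H.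
rewrite pow2_sqrt by nra; field; lra.
Qed.

Lemma mean_H_le_mean_A a b : 0 < a -> 0 < b -> mean_H a b <= mean_A a b.
Proof.
intros ha hb.
assert (gap : mean_A a b - mean_H a b = (a - b) ^ 2 / (2 * (a + b)))
  by (unfold mean_A, mean_H; field; lra).
assert (0 <= (a - b) ^ 2 / (2 * (a + b))).
{ apply Rmult_le_pos; [apply pow2_ge_0 |].
  apply Rlt_le, Rinv_0_lt_compat; lra. }
lra.
Qed.

Lemma mean_G_le_mean_S a b : 0 < a -> 0 < b -> mean_G a b <= mean_S a b.
Proof.
intros ha hb; apply sqrt_le_1_alt.
assert (0 <= (a - b) ^ 2) by apply pow2_ge_0; nra.
Qed.

(** Since S^2 + G^2 = 2 A^2, the difference (2 A)^2 - (S + G)^2 is (S - G)^2. *)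
Lemma mean_S_add_mean_G_le a b : 0 < a -> 0 < b ->
  mean_S a b + mean_G a b <= 2 * mean_A a b.
Proof.
intros ha hb.
assert (hA := mean_A_pos a b ha hb).
assert (hSG := mean_S_sqr_add_mean_G_sqr a b ha hb).
apply Rsqr_incr_0_var; [| lra].
unfold Rsqr.
assert (0 <= (mean_S a b - mean_G a b) ^ 2) by apply pow2_ge_0; nra.
Qed.

(** The difference of the squares of the two sides is (A - H)^2; comparing
    squares is enough because H <= A makes 3 A - H nonnegative. *)
Lemma two_mean_S_le a b : 0 < a -> 0 < b ->
  2 * mean_S a b <= 3 * mean_A a b - mean_H a b.
Proof.
intros ha hb.
assert (hA := mean_A_pos a b ha hb).
assert (hHA := mean_H_le_mean_A a b ha hb).
assert (hSG := mean_S_sqr_add_mean_G_sqr a b ha hb).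
assert (hG := mean_G_sqr a b ha hb).
apply Rsqr_incr_0_var; [| lra].
unfold Rsqr.
assert (0 <= (mean_A a b - mean_H a b) ^ 2) by apply pow2_ge_0; nra.
Qed.

(** Multiplying by 2 A > 0 turns the left side into (S + G)(S - G), and then
    S + G <= 2 A can be used because S - G is nonnegative. *)
Lemma M_AH_le_M_SG a b : 0 < a -> 0 < b -> M_AH a b <= M_SG a b.
Proof.
intros ha hb; unfold M_AH, M_SG.
assert (hA := mean_A_pos a b ha hb).
assert (hSG := mean_S_sqr_add_mean_G_sqr a b ha hb).
assert (hG := mean_G_sqr a b ha hb).
assert (hGS := mean_G_le_mean_S a b ha hb).
assert (hsum := mean_S_add_mean_G_le a b ha hb).
apply Rmult_le_reg_l with (2 * mean_A a b); [lra |].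
replace (2 * mean_A a b * (mean_A a b - mean_H a b))
  with ((mean_S a b + mean_G a b) * (mean_S a b - mean_G a b)) by nra.
apply Rmult_le_compat_r; lra.
Qed.

Theorem theorem3p1 (a b : R) (ha : 0 < a) (hb : 0 < b) :
  M_SA a b <= 1 / 3 * M_SH a b /\
  1 / 3 * M_SH a b <= 1 / 2 * M_AH a b /\
  1 / 2 * M_AH a b <= 1 / 2 * M_SG a b /\
  1 / 2 * M_SG a b <= M_AG a b.
Proof.
assert (h12 := two_mean_S_le a b ha hb).
assert (h3 := M_AH_le_M_SG a b ha hb).
assert (h4 := mean_S_add_mean_G_le a b ha hb).
unfold M_SA, M_SH, M_AH, M_SG, M_AG in *.
repeat split; lra.
Qed.
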